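(* Let $A$ be a great circular arc of geodesic length $L\in(0,2\pi]$ on the unit sphere $\mathbb{S}^2\subset\mathbb{R}^3$, equipped with the distance given by arc-length along $A$, so that $A$ is isometric to the line segment $[0,L]$, and let $P_A$ be the uniform probability measure on $A$ with respect to arc-length. For each $n\ge1$: (i) The optimal set of $n$-means for $P_A$ (with respect to squared distance) is obtained by partitioning $A$ into $n$ adjacent sub-arcs of equal length $L/n$ and placing each representative at the midpoint of its sub-arc. (ii) The $n$th quantization error is $$V_n(P_A)=\frac{L^2}{12\,n^2}.$$
   Context: Quantization: for a metric space $(M,d)$ and a Borel probability measure $P$ on $M$, the distortion of a finite nonempty set (codebook) $\alpha\subset M$ is $V(\alpha;P)=\int_M\min_{a\in\alpha}d(x,a)^2\,dP(x)$, and the $n$th quantization error is $V_n(P)=\inf\{V(\alpha;P):\alpha\subset M,\ 1\le|\alpha|\le n\}$. An optimal set of $n$-means is a set $\alpha\subset M$ with $|\alpha|\le n$ and $V(\alpha;P)=V_n(P)$. Here $M=A$, and $d(x,y)$ is the arc-length of the portion of $A$ between $x$ and $y$; in arc-length coordinates $A=[0,L]$ and $d(s,t)=|s-t|$ (also when $L=2\pi$, where no wrap-around identification of the endpoints is made). *)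

(* Defs.v *)
From HB Require Import structures.
From mathcomp Require Import all_boot all_order all_algebra finmap.
From mathcomp Require Import all_classical all_reals all_analysis.

Set Implicit Arguments.
Unset Strict Implicit.
Unset Printing Implicit Defensive.

Import Order.TTheory GRing.Theory Num.Theory.
Import numFieldNormedType.Exports.

Local Open Scope classical_set_scope.
Local Open Scope ring_scope.

(* The metric space is a subset M of T with distance dist; only the values of
   dist on M * M matter. *)
Section quantization.
Context {R : realType} {d : measure_display} {T : measurableType d}.
Variables (P : probability T R) (M : set T) (dist : T -> T -> R).

(* The minimum is taken in \bar R, where +oo is neutral; on a nonempty codebook
   it is the minimum of the squared distances. *)
Definition distortion (alpha : {fset T}) : \bar R :=
  (\int[P]_(x in M) \big[mine/+oo]_(a <- alpha) ((dist x a) ^+ 2)%:E)%E.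

Definition codebook (n : nat) (alpha : {fset T}) : Prop :=
  {in alpha, forall a, M a} /\ (1 <= #|` alpha| <= n)%N.

Definition quantization_error (n : nat) : \bar R :=
  ereal_inf [set distortion alpha | alpha in codebook n].

Definition optimal_means (n : nat) (alpha : {fset T}) : Prop :=
  codebook n alpha /\ distortion alpha = quantization_error n.

End quantization.

Section great_circular_arc.
Context {R : realType}.

(* The library norm on row vectors is the sup norm, hence the explicit
   Euclidean structure. *)
Definition dotv (x y : 'rV[R]_3) : R := (x *m y^T) 0 0.

Definition enorm (x : 'rV[R]_3) : R := Num.sqrt (dotv x x).

Definition unit_sphere : set 'rV[R]_3 := [set x | enorm x = 1].

Definition curve_length (gamma : R -> 'rV[R]_3) (a b : R) : R :=
  \int[@lebesgue_measure R]_(r in `[a, b]) enorm (derive1 gamma r).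

(* Great circle through u with initial direction v, for u and v orthonormal. *)
Definition great_circle (u v : 'rV[R]_3) (t : R) : 'rV[R]_3 :=
  cos t *: u + sin t *: v.

(* The arc of length L is great_circle u v restricted to [0, L], and a point of
   the arc is represented by its parameter. The parametrisation has unit speed,
   so parameters are arc-length coordinates. For L = 2 pi the parameters 0 and L
   have the same position on the sphere but are distinct points of the arc. *)
Definition arc_dist (u v : 'rV[R]_3) (s t : R) : R :=
  curve_length (great_circle u v) (Num.min s t) (Num.max s t).

(* Uniform law on [0, L] in the arc-length coordinate. *)
Definition arc_uniform (L : R) (L_gt0 : 0 < L) :
  probability (measurableTypeR R) R := uniform_prob L_gt0.

(* The i-th of n adjacent sub-arcs of length L / n is
   [cut_point L n i, cut_point L n i.+1]. *)
Definition cut_point (L : R) (n i : nat) : R := i%:R * (L / n%:R).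

Definition subarc_midpoints (L : R) (n : nat) : {fset R} :=
  [fset (cut_point L n i + cut_point L n i.+1) / 2 | i in iota 0 n]%fset.

End great_circular_arc.

(* Main.v *)
(* Only the midpoints between consecutive codebook points a_1 < ... < a_k matter,
   and cutting [0, L] at them gives
     L V = a_1^3 / 3 + sum_i (a_(i+1) - a_i)^3 / 12 + (L - a_k)^3 / 3,
   i.e. a third of the sum of the cubes of the 2 k distances from a point to the
   ends of its cell, whose total is L. Bounding each cube from below by its
   tangent line at h = L / (2 n) gives the quantization error, with equality only
   if k = n and all those distances are h. *)
Require Import Defs.
From mathcomp Require Import all_boot all_order all_algebra finmap.
From mathcomp Require Import all_classical all_reals all_analysis.
From mathcomp Require Import measurable_realfun ring lra.

Import Order.TTheory GRing.Theory Num.Theory.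
Import numFieldNormedType.Exports.

Local Open Scope classical_set_scope.
Local Open Scope ring_scope.

(** * Arc length along a great circle *)

Lemma dotvE (R : realType) (x y : 'rV[R]_3) : dotv x y = \sum_i x 0 i * y 0 i.
Proof. by rewrite /dotv mxE; apply: eq_bigr => i _; rewrite mxE. Qed.

Lemma derive1_great_circle (R : realType) (u v : 'rV[R]_3) (t : R) :
  derive1 (great_circle u v) t = - sin t *: u + cos t *: v.
Proof.
have dE i j : is_derive t (1 : R) (fun x => great_circle u v x i j)
    (- sin t * u i j + cos t * v i j).
  rewrite (_ : (fun x => _) = (fun x => cos x * u i j + sin x * v i j)); last first.
    by apply/funext => x; rewrite !mxE.
  apply: is_derive_eq; rewrite /GRing.scale/= !mulr0 !add0r; ring.
rewrite derive1E derive_mx; last by apply/derivable_mxP => i j; exact: ex_derive.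
by apply/matrixP => i j; rewrite !mxE; exact: derive_val.
Qed.

Lemma enorm_derive1_great_circle (R : realType) (u v : 'rV[R]_3) (t : R) :
  unit_sphere u -> unit_sphere v -> dotv u v = 0 ->
  enorm (derive1 (great_circle u v) t) = 1.
Proof.
have sphere_dotv (w : 'rV[R]_3) : unit_sphere w -> dotv w w = 1.
  rewrite /unit_sphere/= /enorm => w1.
  have w0 : 0 <= dotv w w.
    by rewrite dotvE sumr_ge0// => i _; rewrite -expr2 sqr_ge0.
  by rewrite -(sqr_sqrtr w0) w1 expr1n.
move=> /sphere_dotv u1 /sphere_dotv v1 uv; rewrite derive1_great_circle /enorm.
rewrite (_ : dotv _ _ = sin t ^+ 2 * dotv u u + cos t ^+ 2 * dotv v v
    - 2 * sin t * cos t * dotv u v); last first.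
  rewrite !dotvE !mulr_sumr -sumrN -!big_split/=; apply: eq_bigr => i _.
  rewrite !mxE; ring.
by rewrite u1 v1 uv !mulr1 mulr0 subr0 addrC cos2Dsin2 sqrtr1.
Qed.

(** Unit speed makes the length of a piece of the curve that of its parameter interval, so even a
    full great circle has no wrap-around. *)
Lemma arc_distE (R : realType) (u v : 'rV[R]_3) (s t : R) :
  unit_sphere u -> unit_sphere v -> dotv u v = 0 ->
  arc_dist u v s t = `|s - t|.
Proof.
move=> hu hv huv; rewrite /arc_dist /curve_length.
under eq_Rintegral do rewrite enorm_derive1_great_circle//.
rewrite Rintegral_cst// mul1r.
rewrite /= lebesgue_measure_itv /= lte_fin.
case: (ltgtP s t) => [st|ts|->] /=; rewrite ?ltxx ?subrr ?normr0//.
  by rewrite st/= ltr0_norm ?subr_lt0// opprB.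
by rewrite ts/= gtr0_norm ?subr_gt0.
Qed.

(** * Tangent-line bound for the cost of an increasing sequence *)

(* [voronoi_cost L a s] is the integral over [a, L] of the squared distance to
   the nonempty increasing sequence [a :: s]. *)
Fixpoint voronoi_cost {R : realType} (L a : R) (s : seq R) : R :=
  if s is b :: s' then (b - a) ^+ 3 / 12 + voronoi_cost L b s'
  else (L - a) ^+ 3 / 3.

(* Tangent line of the cube at [h]: the gap is (y - h)^2 (y + 2 h). *)
Lemma cube_tangent (R : realType) (h y : R) : 0 < h -> 0 <= y ->
  3 * h ^+ 2 * y - 2 * h ^+ 3 <= y ^+ 3 ?= iff (y == h).
Proof.
move=> h0 y0.
have E : y ^+ 3 - (3 * h ^+ 2 * y - 2 * h ^+ 3) = (y - h) ^+ 2 * (y + 2 * h) by ring.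
have yh : 0 < y + 2 * h by lra.
split; first by rewrite -subr_ge0 E mulr_ge0 ?sqr_ge0// ltW.
by rewrite eq_sym -subr_eq0 E mulf_eq0 (gt_eqF yh) orbF sqrf_eq0 subr_eq0.
Qed.

(** The tangent bounds are summed over the [2 * size s + 1] half-cells to the right of [a]: two per
    gap and one up to [L]. The [?= iff] carries the equality case along. *)
Lemma voronoi_cost_lower_bound (R : realType) (L h a : R) (s : seq R) :
  0 < h -> path <=%R a s -> last a s <= L ->
  h ^+ 2 * (L - a) - (2 * (size s)%:R + 1) * (2 * h ^+ 3 / 3)
    <= voronoi_cost L a s
    ?= iff fpath (+%R (2 * h)) a s && (last a s == L - h).
Proof.
move=> h0; elim: s a => [|b s ih] a /=.
  move=> _ aL; have /= [le eq] := @cube_tangent _ h (L - a) h0 ltac:(lra).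
  split; first by lra.
  rewrite (_ : (a == L - h) = (L - a == h)); last by apply/eqP/eqP; lra.
  by rewrite -eq; apply/eqP/eqP; lra.
move=> /andP[ab bs] bL.
(* A gap costs [(b - a) ^+ 3 / 12], which is two thirds of the cube of the half-gap; hence the
   tangent is used at [(b - a) / 2]. *)
have /= [le eq] := @cube_tangent _ h ((b - a) / 2) h0 ltac:(lra).
rewrite -andbA.
have step : h ^+ 2 * (b - a) - 4 * h ^+ 3 / 3 <= (b - a) ^+ 3 / 12
    ?= iff (2 * h + a == b).
  have E : ((b - a) / 2) ^+ 3 = (b - a) ^+ 3 / 8 by field.
  rewrite E in le eq; split; first by lra.
  rewrite (_ : (2 * h + a == b) = ((b - a) / 2 == h)); last by apply/eqP/eqP; lra.
  by rewrite -eq; apply/eqP/eqP; lra.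
have := leifD step (ih b bs bL).
rewrite [X in X <= _ ?= iff _ -> _](_ : _ =
    h ^+ 2 * (L - a) - (2 * (size s).+1%:R + 1) * (2 * h ^+ 3 / 3))//.
by rewrite -addn1 natrD; field.
Qed.

(** * Squared distance to a finite sequence and its integral *)

Definition sqr_dist_to {R : realType} (s : seq R) (x : R) : \bar R :=
  \big[mine/+oo%E]_(a <- s) ((x - a) ^+ 2)%:E.

Lemma sqr_dist_to_nearest (R : realType) (s : seq R) (x a : R) :
  a \in s -> {in s, forall b, (x - a) ^+ 2 <= (x - b) ^+ 2} ->
  sqr_dist_to s x = ((x - a) ^+ 2)%:E.
Proof.
move=> sa amin; apply/eqP; rewrite eq_le; apply/andP; split.
  exact: (@ge_bigmin_seq _ _ _ s +oo%E a predT).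
rewrite /sqr_dist_to big_seq_cond.
by apply: le_bigmin; [rewrite leey | move=> b /andP[/amin]; rewrite lee_fin].
Qed.

(** A minimum ignores order and repetition, so a codebook may be sorted before integrating. *)
Lemma eq_sqr_dist_to (R : realType) (s t : seq R) :
  s =i t -> sqr_dist_to s = sqr_dist_to t.
Proof.
move=> st; apply/funext => x; apply/le_anti/andP; split.
  by apply: sub_bigmin_seq => b; rewrite st.
by apply: sub_bigmin_seq => b; rewrite st.
Qed.

Lemma sqr_dist_to_ge0 (R : realType) (s : seq R) (x : R) :
  (0 <= sqr_dist_to s x)%E.
Proof. by apply: le_bigmin => // b _; rewrite lee_fin sqr_ge0. Qed.

Lemma measurable_sqr_dist_to (R : realType) (s : seq R) (D : set R) :
  measurable_fun D (sqr_dist_to s).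
Proof.
apply: measurable_funTS; elim: s => [|a s ih].
  rewrite (_ : sqr_dist_to [::] = cst +oo%E)//.
  by apply/funext => x; rewrite /sqr_dist_to big_nil.
rewrite (_ : sqr_dist_to _ = fun x => mine ((x - a) ^+ 2)%:E (sqr_dist_to s x)).
  by apply: measurable_mine => //; apply/measurable_EFinP/measurable_funX/measurable_funB.
by apply/funext => x; rewrite /sqr_dist_to big_cons.
Qed.

Lemma ge0_integral_itv_cat (R : realType) (f : R -> \bar R) (a b c : R) :
  a <= b <= c -> measurable_fun setT f -> (forall x, 0 <= f x)%E ->
  (\int[lebesgue_measure]_(x in `[a, c]) f x =
   \int[lebesgue_measure]_(x in `[a, b]) f x +
   \int[lebesgue_measure]_(x in `[b, c]) f x)%E.
Proof.
move=> /andP[ab bc] mf f0.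
(* The disjoint pieces are [[a, b]] and []b, c]]; the point [b] is then added to the second one,
   being a null set. *)
rewrite (@itv_bndbnd_setU _ _ _ (BRight b)); rewrite ?bnd_simp//.
rewrite ge0_integral_setU//=.
- by rewrite -(integral_itv_obnd_cbnd (r := b))//; exact: measurable_funTS.
- exact: measurable_funTS.
- rewrite disj_set2E; apply/eqP; apply/seteqP; split => x //=.
  by rewrite !in_itv/= => -[/andP[_ xb] /andP[bx _]]; move: bx; rewrite ltNge xb.
Qed.

Lemma integral_sqr_dist (R : realType) (c a b : R) : a <= b ->
  (\int[lebesgue_measure]_(x in `[a, b]) ((x - c) ^+ 2)%:E
   = (((b - c) ^+ 3 - (a - c) ^+ 3) / 3)%:E)%E.
Proof.
(* The fundamental theorem of calculus is applied on a nondegenerate interval, so [a = b] is settled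
   first. *)
rewrite le_eqVlt => /predU1P[->|ab].
  by rewrite set_itv1 integral_set1 subrr mul0r.
have dF (x : R) : is_derive x (1 : R) (fun x => (x - c) ^+ 3 / 3) ((x - c) ^+ 2).
  by apply: is_derive_eq; rewrite /GRing.scale/=; field.
have df (x : R) : derivable (fun x => (x - c) ^+ 2) x 1 by [].
have cF : continuous (fun x : R => (x - c) ^+ 3 / 3).
  by move=> x; apply/differentiable_continuous/derivable1_diffP; exact: ex_derive.
rewrite (@continuous_FTC2 _ _ (fun x => (x - c) ^+ 3 / 3))//.
- by rewrite -EFinB mulrBl.
- exact: derivable_within_continuous.
- split.
  + by move=> x _; exact: ex_derive.
  + by apply: cvg_at_right_filter; exact: cF.
  + by apply: cvg_at_left_filter; exact: cF.
- by move=> x _; rewrite derive1E; exact: derive_val.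
Qed.

(** [(x - b) ^+ 2 - (x - a) ^+ 2 = (b - a) * (a + b - 2 * x)], and both factors are nonnegative for
    every later point [b]. *)
Lemma sqr_dist_to_head (R : realType) (a x : R) (s : seq R) :
  path <=%R a s -> {in s, forall b, x <= (a + b) / 2} ->
  sqr_dist_to (a :: s) x = ((x - a) ^+ 2)%:E.
Proof.
move=> as_ xs; apply: sqr_dist_to_nearest; first exact: mem_head.
move=> b; rewrite inE => /predU1P[->//|sb].
have ab : a <= b by move/(order_path_min le_trans)/allP: as_; exact.
have := xs _ sb; rewrite -subr_ge0 => xab.
by rewrite -subr_ge0; nra.
Qed.

(* Cut [a, L] at the midpoint of the first two points and at the second one:
   [a] no longer matters to the right of [b]. *)
Lemma integral_sqr_dist_to (R : realType) (L a : R) (s : seq R) :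
  path <=%R a s -> last a s <= L ->
  (\int[lebesgue_measure]_(x in `[a, L]) sqr_dist_to (a :: s) x
   = (voronoi_cost L a s)%:E)%E.
Proof.
elim: s a => [|b s ih] a.
  move=> _ /= aL; under eq_integral do rewrite sqr_dist_to_head//.
  by rewrite integral_sqr_dist// subrr expr0n subr0.
move=> /= /andP[ab bs] bL.
have b_min : {in s, forall c, b <= c}.
  by move=> c; move/(order_path_min le_trans)/allP: bs; exact.
have bL' : b <= L.
  by apply: le_trans bL; have := mem_last b s; rewrite inE => /predU1P[->//|/b_min].
have mf := @measurable_sqr_dist_to R [:: a, b & s] setT.
rewrite (@ge0_integral_itv_cat _ _ a b)//; last 2 first.
  by rewrite ab.
  exact: sqr_dist_to_ge0.
rewrite (@ge0_integral_itv_cat _ _ a ((a + b) / 2) b)//; last 2 first.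
  by apply/andP; split; lra.
  exact: sqr_dist_to_ge0.
have -> : (\int[lebesgue_measure]_(x in `[b, L]) sqr_dist_to [:: a, b & s] x
    = (voronoi_cost L b s)%:E)%E.
  rewrite -ih//; apply: eq_integral => x; rewrite inE/= in_itv/= => /andP[bx _].
  rewrite /sqr_dist_to big_cons; apply/min_idPr.
  apply: (@le_trans _ _ ((x - b) ^+ 2)%:E).
    by apply: (@ge_bigmin_seq _ _ _ (b :: s) +oo%E b predT) => //; exact: mem_head.
  by rewrite lee_fin ler_sqr ?nnegrE; lra.
under eq_integral => x.
  rewrite inE/= in_itv/= => /andP[ax xm].
  rewrite sqr_dist_to_head; [|by rewrite /= ab|]; last first.
    by move=> c; rewrite inE => /predU1P[->//|/b_min bc]; lra.
  over.
rewrite integral_sqr_dist; last lra.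
under [X in (_ + X + _)%E]eq_integral => x.
  rewrite inE/= in_itv/= => /andP[mx xb].
  rewrite (@sqr_dist_to_nearest _ _ _ b); [|by rewrite !inE eqxx orbT|]; last first.
    move=> c; rewrite !inE => /or3P[/eqP->|/eqP->//|/b_min bc].
      by rewrite -subr_ge0; nra.
    by rewrite -subr_ge0; nra.
  over.
rewrite integral_sqr_dist; last lra.
by rewrite -!EFinD; congr EFin; field.
Qed.

(** Left of [a] the head is the nearest point, so the outer half of the first cell adds
    [a ^+ 3 / 3]. *)
Lemma integral_sqr_dist_to_above (R : realType) (L a : R) (s : seq R) :
  0 <= a -> path <=%R a s -> last a s <= L ->
  (\int[lebesgue_measure]_(x in `[0%R, L]) sqr_dist_to (a :: s) x
   = (a ^+ 3 / 3 + voronoi_cost L a s)%:E)%E.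
Proof.
move=> a0 as_ sL.
have a_min : {in s, forall c, a <= c}.
  by move=> c; move/(order_path_min le_trans)/allP: as_; exact.
have aL : a <= L.
  by apply: le_trans sL; have := mem_last a s; rewrite inE => /predU1P[->//|/a_min].
rewrite (@ge0_integral_itv_cat _ _ _ a); last 3 first.
  by rewrite a0.
  exact: measurable_sqr_dist_to.
  exact: sqr_dist_to_ge0.
rewrite integral_sqr_dist_to//.
under eq_integral => x.
  rewrite inE/= in_itv/= => /andP[x0 xa].
  rewrite sqr_dist_to_head//; last by move=> c /a_min ac; lra.
  over.
by rewrite integral_sqr_dist// -EFinD subrr; congr EFin; field.
Qed.

(** * Sharp lower bound on the whole arc *)

Lemma arc_cost_lower_bound (R : realType) (L a : R) (s : seq R) (n : nat) :
  0 < L -> 0 <= a -> path <=%R a s -> last a s <= L -> (size s < n)%N ->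
  L ^+ 3 / (12 * n%:R ^+ 2) <= a ^+ 3 / 3 + voronoi_cost L a s
    ?= iff (a :: s == traject (+%R (L / n%:R)) (L / n%:R / 2) n).
Proof.
move=> L0 a0 as_ sL sn; set h : R := L / n%:R / 2.
have n0 : 0 < n%:R :> R by rewrite ltr0n (leq_ltn_trans _ sn).
have nN0 : n%:R != 0 :> R by rewrite gt_eqF.
have h0 : 0 < h by rewrite !divr_gt0.
have Ln : L / n%:R = 2 * h by rewrite /h; field.
have LE : L = 2 * n%:R * h by rewrite /h; field.
have LnE : L ^+ 3 / (12 * n%:R ^+ 2) = 2 * n%:R * h ^+ 3 / 3 by rewrite /h; field.
(* The right-hand side is the sum of all tangent bounds. Each point short of [n] raises it by
   [4 * h ^+ 3 / 3], so smaller codebooks are strictly worse. *)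
have card_le : 2 * n%:R * h ^+ 3 / 3
    <= h ^+ 2 * L - 2 * (size s).+1%:R * (2 * h ^+ 3 / 3) ?= iff (n == (size s).+1).
  have E : h ^+ 2 * L - 2 * (size s).+1%:R * (2 * h ^+ 3 / 3) - 2 * n%:R * h ^+ 3 / 3
      = 4 * h ^+ 3 / 3 * (n%:R - (size s).+1%:R) by rewrite LE; field.
  have h3 : 0 < 4 * h ^+ 3 / 3 by rewrite divr_gt0// mulr_gt0// exprn_gt0.
  split; first by rewrite -subr_ge0 E pmulr_rge0// subr_ge0 ler_nat.
  by rewrite eq_sym -subr_eq0 E mulf_eq0 gt_eqF//= subr_eq0 eqr_nat.
have head_le : h ^+ 2 * a - 2 * h ^+ 3 / 3 <= a ^+ 3 / 3 ?= iff (a == h).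
  have /= [le eq] := @cube_tangent _ h a h0 a0.
  split; first by lra.
  by rewrite -eq; apply/eqP/eqP; lra.
have tail_le := @voronoi_cost_lower_bound _ L h a s h0 as_ sL.
have := leifD head_le tail_le.
rewrite [X in X <= _ ?= iff _ -> _](_ : _ =
    h ^+ 2 * L - 2 * (size s).+1%:R * (2 * h ^+ 3 / 3)); last first.
  by rewrite -addn1 natrD; field.
move=> /(leif_trans card_le); rewrite LnE Ln.
congr (_ <= _ ?= iff _).
apply/idP/eqP => [/and4P[/eqP-> /eqP ah /fpathE sE _]|].
  by rewrite ah in sE *; rewrite /= -sE.
case: n sn n0 nN0 @h h0 Ln LE LnE card_le head_le tail_le => // n sn n0 nN0 h h0 Ln LE _ _ _ _ [ah sE].
have -> : size s = n by rewrite sE size_traject.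
rewrite sE ah fpath_traject last_traject iter_addr !eqxx/=.
(* The condition at the right end is automatic: the last of the [n.+1] points is
   [h + 2 * n * h = L - h]. *)
by rewrite [X in _ == X - _]LE -addn1 natrD; apply/eqP; rewrite -mulr_natr; ring.
Qed.

(** * The codebook of sub-arc midpoints *)

Lemma mem_subarc_midpoints (R : realType) (L : R) (n : nat) :
  subarc_midpoints L n =i traject (+%R (L / n%:R)) (L / n%:R / 2) n.
Proof.
(* Both sides are [(2 * i + 1) * L / (2 * n)]. *)
have midE i : (i < n)%N -> iter i (+%R (L / n%:R)) (L / n%:R / 2) =
    (cut_point L n i + cut_point L n i.+1) / 2.
  move=> i_n; rewrite iter_addr /cut_point -mulr_natr -(addn1 i) natrD.
  by field; rewrite pnatr_eq0 -lt0n (leq_ltn_trans _ i_n).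
move=> x; apply/imfsetP/trajectP => /= [[i]|[i i_n ->]].
  by rewrite mem_iota add0n => /andP[_ i_n] ->; exists i; rewrite ?midE.
by exists i; rewrite ?mem_iota ?midE.
Qed.

Lemma sort_subarc_midpoints (R : realType) (L : R) (n : nat) :
  0 < L -> (1 <= n)%N ->
  sort <=%R (subarc_midpoints L n) =
    traject (+%R (L / n%:R)) (L / n%:R / 2) n.
Proof.
(* A finite set has only one strictly increasing enumeration, and the progression is one because its
   step [L / n] is positive. *)
move=> L0 n0; apply: lt_sorted_eq.
- by rewrite sort_lt_sorted fset_uniq.
- case: n n0 => // n _; rewrite /=.
  apply: sub_path (fpath_traject _ _ _) => x y /eqP<-.
  by rewrite ltrDr divr_gt0.
- by move=> x; rewrite mem_sort mem_subarc_midpoints.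
Qed.

Lemma codebook_subarc_midpoints (R : realType) (L : R) (n : nat) :
  0 < L -> (1 <= n)%N -> codebook `[0, L] n (subarc_midpoints L n).
Proof.
move=> L0 n1; split; last first.
  by rewrite -(size_sort <=%R) sort_subarc_midpoints// size_traject n1 leqnn.
move=> x; rewrite mem_subarc_midpoints => /trajectP[i i_n ->].
have n0 : 0 < n%:R :> R by rewrite ltr0n.
rewrite /= in_itv/= iter_addr -mulr_natr.
have d0 : 0 < L / n%:R by rewrite divr_gt0.
have id0 : 0 <= L / n%:R * i%:R by rewrite mulr_ge0// ltW.
(* Sub-arc [i] ends at [(i + 1) * L / n], which is at most [L], and its midpoint comes before
   that. *)
have : L / n%:R * (i%:R + 1) <= L / n%:R * n%:R.
  by rewrite ler_pM2l// natr1 ler_nat.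
by rewrite divfK ?gt_eqF//; lra.
Qed.

(** Carries the equality case back from sorted sequences to codebooks. *)
Lemma eq_subarc_midpoints (R : realType) (L : R) (n : nat) (alpha : {fset R}) :
  0 < L -> (1 <= n)%N ->
  (sort <=%R alpha == traject (+%R (L / n%:R)) (L / n%:R / 2) n)
    = (alpha == subarc_midpoints L n).
Proof.
move=> L0 n1; rewrite -sort_subarc_midpoints//; apply/eqP/eqP => [E|->//].
by apply/fsetP => x; rewrite -(mem_sort <=%R) E mem_sort.
Qed.

(** * Distortion under the uniform law *)

Lemma distortion_arc (R : realType) (u v : 'rV[R]_3) (L : R) (L0 : 0 < L)
    (alpha : {fset R}) :
  unit_sphere u -> unit_sphere v -> dotv u v = 0 ->
  distortion (arc_uniform L0) `[0, L] (arc_dist u v) alpha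
  = (L^-1%:E *
     \int[lebesgue_measure]_(x in `[0%R, L]) sqr_dist_to (sort <=%R alpha) x)%E.
Proof.
move=> hu hv huv; rewrite /distortion.
transitivity
    (\int[arc_uniform L0]_(x in `[0%R, L]) sqr_dist_to (sort <=%R alpha) x)%E.
  apply: eq_integral => x _.
  rewrite (@eq_sqr_dist_to _ _ alpha); last by move=> y; rewrite mem_sort.
  by apply: eq_bigr => b _; rewrite arc_distE// real_normK// num_real.
(* [integral_uniform] concerns integrals over the whole line, so the integrand is first extended by
   zero outside [[0, L]]. *)
rewrite integral_mkcond integral_uniform; last 2 first.
- by apply/(measurable_restrictT _ _).1 => //; exact: measurable_sqr_dist_to.
- by move=> x; apply: erestrict_ge0 => y _; exact: sqr_dist_to_ge0.
rewrite subr0; congr (_ * _)%E.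
by apply: eq_integral => x xL; rewrite patchE xL.
Qed.

Lemma distortion_arc_lower_bound (R : realType) (u v : 'rV[R]_3) (L : R)
    (L0 : 0 < L) (n : nat) (alpha : {fset R}) :
  unit_sphere u -> unit_sphere v -> dotv u v = 0 ->
  codebook `[0, L] n alpha ->
  exists2 r, distortion (arc_uniform L0) `[0, L] (arc_dist u v) alpha = r%:E &
    L ^+ 2 / (12 * n%:R ^+ 2) <= r ?= iff (alpha == subarc_midpoints L n).
Proof.
move=> hu hv huv [alphaL /andP[alpha1 alphan]].
have n1 := leq_trans alpha1 alphan.
rewrite distortion_arc// -eq_subarc_midpoints//.
have : sorted <=%R (sort <=%R alpha) by exact: sort_le_sorted.
have : {in sort <=%R alpha, forall a, 0 <= a <= L}.
  by move=> a; rewrite mem_sort => /alphaL; rewrite /= in_itv.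
have : (0 < size (sort <=%R alpha) <= n)%N by rewrite size_sort alpha1.
case: (sort <=%R alpha) => // a s /= sn sL as_.
have /andP[a0 _] := sL a (mem_head _ _).
have /andP[_ lastL] := sL _ (mem_last a s).
rewrite integral_sqr_dist_to_above// -EFinM; eexists; first by [].
have [le eq] := @arc_cost_lower_bound _ L a s n L0 a0 as_ lastL sn.
(* The cost bound is for [L] times the distortion. *)
have -> : L ^+ 2 / (12 * n%:R ^+ 2) = L^-1 * (L ^+ 3 / (12 * n%:R ^+ 2)).
  by field; rewrite pnatr_eq0 -lt0n n1 gt_eqF.
split; first by rewrite ler_pM2l ?invr_gt0.
by rewrite (inj_eq (mulfI _))// invr_eq0 gt_eqF.
Qed.

Theorem theorem6p1p1 (R : realType) (u v : 'rV[R]_3)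
    (hu : unit_sphere u) (hv : unit_sphere v) (huv : dotv u v = 0)
    (L : R) (L_gt0 : 0 < L) (L_le : L <= 2 * pi)
    (n : nat) (n_ge1 : (1 <= n)%N) :
  (forall alpha : {fset R},
     optimal_means (arc_uniform L_gt0) `[0, L] (arc_dist u v) n alpha
       <-> alpha = subarc_midpoints L n)
  /\ quantization_error (arc_uniform L_gt0) `[0, L] (arc_dist u v) n
     = (L ^+ 2 / (12 * n%:R ^+ 2))%:E.
Proof.
have lb alpha := @distortion_arc_lower_bound R u v L L_gt0 n alpha hu hv huv.
have cb := @codebook_subarc_midpoints R L n L_gt0 n_ge1.
have midE : distortion (arc_uniform L_gt0) `[0, L] (arc_dist u v)
    (subarc_midpoints L n) = (L ^+ 2 / (12 * n%:R ^+ 2))%:E.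
  by have [r -> [_]] := lb _ cb; rewrite eqxx => /eqP ->.
have errE : quantization_error (arc_uniform L_gt0) `[0, L] (arc_dist u v) n
    = (L ^+ 2 / (12 * n%:R ^+ 2))%:E.
  apply/le_anti/andP; split.
    by apply: ereal_inf_lbound; exists (subarc_midpoints L n).
  by apply: le_ereal_inf_tmp => _ [alpha /lb[r -> [le _]] <-]; rewrite lee_fin.
(* An optimal codebook attains the bound, and the equality case of [lb] identifies it. *)
split=> // alpha; rewrite /optimal_means errE; split=> [[/lb[r -> [_ eq]] [rE]]|->//].
by apply/eqP; rewrite -eq rE.
Qed.
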